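(* Let $\mathbf{E}_J$ be a $W$-graph ideal with respect to $J\subseteq S$ and $L$, let $M=M(\mathbf{E}_J,L)$, $\widetilde M=\widetilde M(\mathbf{E}_J,L)$ be the associated dual pair of $\mathcal H$-modules with duality maps $\eta:M\to\widetilde M$ and $\theta=\eta^{-1}$, and let $\{\mathbf{C}_w\}$, $\{\widetilde{\mathbf{C}}_w\}$ be their Kazhdan–Lusztig bases, $\mathbf{C}_w=\sum_yP_{y,w}\Gamma_y$, $\widetilde{\mathbf{C}}_w=\sum_y\widetilde P_{y,w}\widetilde\Gamma_y$. Put $\mathbf{C}'_w=\theta(\widetilde{\mathbf{C}}_w)$ and $\widetilde{\mathbf{C}}'_w=\eta(\mathbf{C}_w)$ for $w\in\mathbf{E}_J$. Then: (a) $\{\mathbf{C}'_w\mid w\in\mathbf{E}_J\}$ is the unique basis of $M$ such that $\overline{\mathbf{C}'_w}=\mathbf{C}'_w$ for all $w\in\mathbf{E}_J$ and $$\mathbf{C}'_w=\sum_{y\in\mathbf{E}_J}\epsilon_y\overline{\widetilde P_{y,w}}\,\Gamma_y$$ for some elements $\widetilde P_{y,w}\in A_{\geqslant 0}$ with the following properties: (a1) $\widetilde P_{y,w}=0$ if $y\not\leqslant w$; (a2) $\widetilde P_{w,w}=1$; (a3) $\widetilde P_{y,w}$ has zero constant term if $y\neq w$, and $$\overline{\widetilde P_{y,w}}-\widetilde P_{y,w}=\sum_{\substack{x\in\mathbf{E}_J\\ y<x\leqslant w}}\overline{\widetilde R_{y,x}}\,\widetilde P_{x,w}\qquad\text{for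 any } y<w.$$ (b) Analogously, $\{\widetilde{\mathbf{C}}'_w\mid w\in\mathbf{E}_J\}$ is a basis of $\widetilde M$, and $\widetilde{\mathbf{C}}'_w=\sum_{y\in\mathbf{E}_J}\epsilon_y\overline{P_{y,w}}\,\widetilde\Gamma_y$.
   Context: Let $(W,S)$ be a Coxeter system with length function $\ell$ and Bruhat order $\leqslant$; put $\epsilon_w=(-1)^{\ell(w)}$. Let $\Gamma$ be a totally ordered abelian group (written additively) and $L:W\to\Gamma$ a weight function: elements $L(s)\in\Gamma$ ($s\in S$) are given with $L(s)=L(t)$ whenever $s,t$ are conjugate in $W$, and $L(w)=L(s_1)+\dots+L(s_k)$ for a reduced expression $w=s_1\cdots s_k$. Assume $L(s)\geqslant 0$ for all $s\in S$. Let $R\subseteq\mathbb C$ be a subring and $A=R[\Gamma]$ the group algebra, with $R$-basis $\{q^\gamma\mid\gamma\in\Gamma\}$, $q^\gamma q^{\gamma'}=q^{\gamma+\gamma'}$. $A_{\geqslant0}$, $A_{>0}$ are the sets of $R$-linear combinations of $q^\gamma$ with $\gamma\geqslant 0$, $\gamma>0$; the constant term is the coefficient of $q^0$. The ring involution $a\mapsto\overline a$ of $A$ is the $R$-linear map with $\overline{q^\gamma}=q^{-\gamma}$. $\mathcal H$ is the Hecke algebra over $A$ with basis $\{T_w\mid w\in W\}$ and $T_sT_w=T_{sw}$ if $\ell(sw)>\ell(w)$, $T_sT_w=T_{sw}+(q^{L(s)}-q^{-L(s)})T_w$ if $\ell(sw)<\ell(w)$. It has the ring involution $\overline{\sum a_wT_w}=\sum\overline{a_w}\,T_{w^{-1}}^{-1}$.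 $\Phi:\mathcal H\to\mathcal H$ is the $A$-algebra involution with $\Phi(T_w)=\epsilon_w\overline{T_w}$. For $J\subseteq S$ let $D_J=\{w\in W\mid\ell(ws)>\ell(w)\text{ for all }s\in J\}$. The left weak order: $x\leqslant_L y$ iff $y=zx$ with $\ell(y)=\ell(z)+\ell(x)$. Let $\mathbf{E}_J$ be an ideal (down-closed subset) of $(W,\leqslant_L)$ containing $1$ with $\mathbf{E}_J\subseteq D_J$. For $s\in S$ put $\mathbf{E}_{J,s}^-=\{w\in\mathbf{E}_J\mid\ell(sw)<\ell(w),\ sw\in\mathbf{E}_J\}$, $\mathbf{E}_{J,s}^+=\{w\in\mathbf{E}_J\mid\ell(sw)>\ell(w),\ sw\in\mathbf{E}_J\}$, $\mathbf{E}_{J,s}^{0,-}=\{w\in\mathbf{E}_J\mid\ell(sw)>\ell(w),\ sw\notin D_J\}$, $\mathbf{E}_{J,s}^{0,+}=\{w\in\mathbf{E}_J\mid\ell(sw)>\ell(w),\ sw\in D_J\setminus\mathbf{E}_J\}$. $\mathbf{E}_J$ is a $W$-graph ideal with respect to $J$ and $L$ if: (i) there is an $A$-free $\mathcal H$-module $M(\mathbf{E}_J,L)$ with $A$-basis $\{\Gamma_w\mid w\in\mathbf{E}_J\}$ such that for all $s\in S$, $w\in\mathbf{E}_J$: $T_s\Gamma_w=\Gamma_{sw}+(q^{L(s)}-q^{-L(s)})\Gamma_w$ if $w\in\mathbf{E}_{J,s}^-$; $T_s\Gamma_w=\Gamma_{sw}$ if $w\in\mathbf{E}_{J,s}^+$;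 $T_s\Gamma_w=-q^{-L(s)}\Gamma_w$ if $w\in\mathbf{E}_{J,s}^{0,-}$; $T_s\Gamma_w=q^{L(s)}\Gamma_w-\sum_{z\in\mathbf{E}_J,\,z<w}r^s_{z,w}\Gamma_z$ if $w\in\mathbf{E}_{J,s}^{0,+}$, for some $r^s_{z,w}\in q^{L(s)}A_{>0}$; (ii) $M(\mathbf{E}_J,L)$ admits an $A$-semilinear involution $\alpha\mapsto\overline\alpha$ with $\overline{\Gamma_1}=\Gamma_1$ and $\overline{h\alpha}=\overline h\,\overline\alpha$ for all $h\in\mathcal H$, $\alpha\in M(\mathbf{E}_J,L)$. The dual module $\widetilde M(\mathbf{E}_J,L)$ is the $\mathcal H$-module with $A$-basis $\{\widetilde\Gamma_w\mid w\in\mathbf{E}_J\}$ and $T_s\widetilde\Gamma_w=\widetilde\Gamma_{sw}+(q^{L(s)}-q^{-L(s)})\widetilde\Gamma_w$, $\ \widetilde\Gamma_{sw}$, $\ q^{L(s)}\widetilde\Gamma_w$, $\ -q^{-L(s)}\widetilde\Gamma_w+\sum_{z\in\mathbf{E}_J,z<w}\epsilon_z\epsilon_w\overline{r^s_{z,w}}\,\widetilde\Gamma_z$ according as $w\in\mathbf{E}_{J,s}^-,\mathbf{E}_{J,s}^+,\mathbf{E}_{J,s}^{0,-},\mathbf{E}_{J,s}^{0,+}$; it carries an $A$-semilinear involution with $\overline{\widetilde\Gamma_1}=\widetilde\Gamma_1$ and $\overline{h\widetilde\alpha}=\overline h\,\overline{\widetilde\alpha}$. The map $\eta:M\to\widetilde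 M$ is the unique map with $\eta(\Gamma_1)=\widetilde\Gamma_1$ and $\eta(hm)=\Phi(h)\eta(m)$ for $h\in\mathcal H$, $m\in M$; it is bijective, commutes with the involutions, and $\theta=\eta^{-1}$. Explicitly $\eta(\Gamma_w)=\epsilon_w\overline{\widetilde\Gamma_w}$ and $\theta(\widetilde\Gamma_w)=\epsilon_w\overline{\Gamma_w}$. The elements $\widetilde R_{x,y}\in A$ are defined by $\overline{\widetilde\Gamma_y}=\sum_{x\in\mathbf{E}_J}\widetilde R_{x,y}\widetilde\Gamma_x$. Kazhdan–Lusztig bases (known from earlier work): $\mathbf{C}_w=\sum_{y\in\mathbf{E}_J}P_{y,w}\Gamma_y$ is the unique element of $M$ with $\overline{\mathbf{C}_w}=\mathbf{C}_w$, $P_{y,w}\in A_{\geqslant0}$, $P_{y,w}=0$ if $y\not\leqslant w$, $P_{w,w}=1$, and $P_{y,w}$ with zero constant term if $y\ne w$. $\widetilde{\mathbf{C}}_w=\sum_{y\in\mathbf{E}_J}\widetilde P_{y,w}\widetilde\Gamma_y\in\widetilde M$ is characterized in the same way in $\widetilde M$. *)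

(* Defs.v *)
From HB Require Import structures.
From mathcomp Require Import all_boot all_order all_algebra.
From mathcomp Require Import finmap.
From mathcomp Require Import boolp classical_sets functions cardinality fsbigop.
From mathcomp Require Import reals.
From mathcomp.real_closed Require Import complex.
From mathcomp.multinomials Require Import monalg.
From Stdlib Require Import Relations.

Set Implicit Arguments.
Unset Strict Implicit.
Unset Printing Implicit Defensive.

Import Order.TTheory GRing.Theory Num.Theory.

Local Open Scope classical_set_scope.
Local Open Scope ring_scope.

Section SubringType.
Variables (C : comNzRingType) (R : subringClosed C).

Record subring_type : predArgType :=
  SubringElt { subring_val : C; _ : subring_val \in R }.

HB.instance Definition _ := [isSub for subring_val].
HB.instance Definition _ := [Choice of subring_type by <:].
HB.instance Definition _ := [SubChoice_isSubComNzRing of subring_type by <:].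
End SubringType.

HB.mixin Record isTotallyOrderedGroup G of Num.POrderedZmodule G := {
  tog_total : forall x y : G, (x <= y) || (y <= x);
  tog_leD2r : forall x y z : G, x <= y -> x + z <= y + z
}.

#[short(type="orderedGroupType")]
HB.structure Definition OrderedGroup :=
  { G of Num.POrderedZmodule G & isTotallyOrderedGroup G }.

(* [monalg] only puts a ring structure on {malg R[K]} when K is a monoid
   without nontrivial units, so the convolution product of R[G] for a group G
   is defined here, on an alias that keeps the additive structure. *)
Section GroupAlgebra.
Variables (R : comNzRingType) (G : zmodType).

Definition groupAlg : Type := {malg R[G]}.
HB.instance Definition _ := GRing.Zmodule.copy groupAlg {malg R[G]}.

Implicit Types a b c : groupAlg.

Definition qpow (g : G) : groupAlg := << 1 *g g >>.

Definition ga_mul a b : groupAlg :=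
  \sum_(g <- msupp a) \sum_(h <- msupp b) << a@_g * b@_h *g (g + h)%R >>.

Lemma ga_mulw (d1 d2 : {fset G}) a b :
  (msupp a `<=` d1)%fset -> (msupp b `<=` d2)%fset ->
  ga_mul a b = \sum_(g <- d1) \sum_(h <- d2) << a@_g * b@_h *g (g + h)%R >>.
Proof.
move=> le1 le2; rewrite /ga_mul (big_fset_incl _ le1) /=.
  apply/eq_bigr=> k1 _; apply/big_fset_incl => // k _ /mcoeff_outdom ->.
  by rewrite mulr0 monalgU0.
move=> k _ /mcoeff_outdom ak.
by rewrite big1 => // k' _; rewrite ak mul0r monalgU0.
Qed.

Lemma ga_mulC : commutative ga_mul.
Proof.
move=> a b; rewrite /ga_mul exchange_big /=.
by apply/eq_bigr=> g _; apply/eq_bigr=> h _; rewrite mulrC addrC.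
Qed.

Lemma ga_mulDl : left_distributive ga_mul +%R.
Proof.
move=> a b c.
rewrite [in RHS](ga_mulw (fsubsetUl _ (msupp b)) (fsubset_refl _)).
rewrite [in RHS](ga_mulw (fsubsetUr (msupp a) _) (fsubset_refl _)).
rewrite (ga_mulw (msuppD_le _ _) (fsubset_refl _)).
rewrite -big_split /=; apply/eq_bigr=> k1 _.
rewrite -big_split /=; apply/eq_bigr=> k2 _.
by rewrite mcoeffD mulrDl monalgUD.
Qed.

Lemma ga_mulDr : right_distributive ga_mul +%R.
Proof. by move=> a b c; rewrite !(ga_mulC a) ga_mulDl. Qed.

Lemma ga_mul0l a : ga_mul 0 a = 0.
Proof. by rewrite /ga_mul msupp0 big_seq_fset0. Qed.

Lemma ga_mul0r a : ga_mul a 0 = 0.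
Proof. by rewrite ga_mulC ga_mul0l. Qed.

Lemma ga_mulUU (x y : R) (g h : G) :
  ga_mul << x *g g >> << y *g h >> = << x * y *g (g + h)%R >>.
Proof. by rewrite (ga_mulw msuppU_le msuppU_le) !big_seq_fset1 !mcoeffUU. Qed.

Lemma ga_mulU (x : R) (g : G) b :
  ga_mul << x *g g >> b = \sum_(h <- msupp b) << x * b@_h *g (g + h)%R >>.
Proof.
by rewrite (ga_mulw msuppU_le (fsubset_refl _)) big_seq_fset1 mcoeffUU.
Qed.

Lemma ga_mulEl a b :
  ga_mul a b = \sum_(g <- msupp a) ga_mul << a@_g *g g >> b.
Proof. by apply/eq_bigr=> g _; rewrite ga_mulU. Qed.

Lemma ga_mulEr a b :
  ga_mul a b = \sum_(h <- msupp b) ga_mul a << b@_h *g h >>.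
Proof.
by rewrite ga_mulC ga_mulEl; apply/eq_bigr=> h _; rewrite ga_mulC.
Qed.

Lemma ga_mul1 : left_id (qpow 0) ga_mul.
Proof.
move=> a; rewrite ga_mulU [RHS]monalgE.
by apply/eq_bigr=> g _; rewrite mul1r add0r.
Qed.

Lemma ga_mul_suml I (r : seq I) (F : I -> groupAlg) b :
  ga_mul (\sum_(i <- r) F i) b = \sum_(i <- r) ga_mul (F i) b.
Proof. exact: (big_morph (ga_mul^~ b) (fun x y => ga_mulDl x y b) (ga_mul0l b)). Qed.

Lemma ga_mul_sumr I (r : seq I) (F : I -> groupAlg) a :
  ga_mul a (\sum_(i <- r) F i) = \sum_(i <- r) ga_mul a (F i).
Proof. exact: (big_morph (ga_mul a) (fun x y => ga_mulDr a x y) (ga_mul0r a)). Qed.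

Lemma ga_mulA : associative ga_mul.
Proof.
move=> a b c; rewrite (ga_mulEl a b) (ga_mulEl a (ga_mul b c)) ga_mul_suml.
apply: eq_bigr => g _; rewrite (ga_mulEl b c) ga_mul_sumr (ga_mulEr _ b).
rewrite ga_mul_suml; apply: eq_bigr => h _.
rewrite (ga_mulEr << b@_h *g h >> c) ga_mul_sumr (ga_mulEr (ga_mul _ _) c).
by apply: eq_bigr => k _; rewrite !ga_mulUU mulrA addrA.
Qed.

Lemma ga_one_neq0 : qpow 0 != 0.
Proof.
by apply/eqP=> /(congr1 (mcoeff 0)) /eqP; rewrite mcoeffUU mcoeff0 oner_eq0.
Qed.

HB.instance Definition _ := GRing.Zmodule_isComNzRing.Build groupAlg
  ga_mulA ga_mulC ga_mul1 ga_mulDl ga_one_neq0.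

Definition gbar a : groupAlg := \sum_(g <- msupp a) << a@_g *g (- g)%R >>.

Lemma qpowD (g h : G) : qpow g * qpow h = qpow (g + h).
Proof. by rewrite [LHS]ga_mulUU mulr1. Qed.

Lemma gbar_coeff a (g : G) : (gbar a)@_g = a@_(- g).
Proof.
rewrite /gbar raddf_sum /= [in RHS](monalgE a) raddf_sum /=.
by apply: eq_bigr => h _; rewrite !mcoeffU eqr_oppLR.
Qed.

Definition const_term (a : groupAlg) : R := a@_(0 : G).
End GroupAlgebra.

Section Positivity.
Variables (R : comNzRingType) (G : orderedGroupType).

Definition A_ge0 : set (groupAlg R G) :=
  [set a | forall g : G, a@_g != 0 -> 0 <= g].
Definition A_gt0 : set (groupAlg R G) :=
  [set a | forall g : G, a@_g != 0 -> 0 < g].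
End Positivity.

Section Coxeter.
Variables (W : groupType) (S : set W).

(* m s t = 0 encodes m(s,t) = infinity; the relation below is then void. *)
Definition coxeter_matrix (m : W -> W -> nat) : Prop :=
  [/\ forall s, S s -> m s s = 1%N,
      forall s t, S s -> S t -> m s t = m t s
    & forall s t, S s -> S t -> s <> t -> m s t <> 1%N].

Definition is_word (w : W) (u : seq W) : Prop :=
  (forall s, s \in u -> S s) /\ w = (\prod_(s <- u) s)%g.

(* W = < S | (st)^m(s,t) = 1 for s, t in S with m(s,t) finite >. *)
Definition coxeter_system : Prop :=
  exists m : W -> W -> nat,
  [/\ coxeter_matrix m,
      forall w, exists u, is_word w u,
      forall s t, S s -> S t -> ((s * t) ^+ m s t = 1)%g
    & forall (X : groupType) (f : W -> X),
        (forall s t, S s -> S t -> ((f s * f t) ^+ m s t = 1)%g) ->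
        exists g : W -> X,
          (forall x y, g (x * y)%g = (g x * g y)%g) /\
          (forall s, S s -> g s = f s)].

(* The value is 0 on elements that are not products of elements of S; there
   are none in a Coxeter system. *)
Definition len (w : W) : nat :=
  if pselect (exists n, `[< exists2 u, is_word w u & size u = n >])
  is left ex then ex_minn ex else 0%N.

Definition is_reduced (w : W) (u : seq W) : Prop :=
  is_word w u /\ size u = len w.

Definition reflection (t : W) : Prop :=
  exists w s, S s /\ t = (w * s * w^-1)%g.

Definition bruhat_step (x y : W) : Prop :=
  (exists2 t, reflection t & y = (x * t)%g) /\ (len x < len y)%N.
Definition bruhat_le : W -> W -> Prop := clos_refl_trans W bruhat_step.
Definition bruhat_lt (x y : W) : Prop := bruhat_le x y /\ x <> y.

Definition left_weak_le (x y : W) : Prop :=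
  exists z, y = (z * x)%g /\ len y = (len z + len x)%N.

Definition weight_function (G : zmodType) (L : W -> G) : Prop :=
  (forall s t w, S s -> S t -> t = (w * s * w^-1)%g -> L s = L t) /\
  (forall w u, is_reduced w u -> L w = \sum_(s <- u) L s).

Definition D_set (J : set W) : set W :=
  [set w | forall s, J s -> (len w < len (w * s)%g)%N].

Definition weak_order_ideal (E : set W) : Prop :=
  forall x y, E y -> left_weak_le x y -> E x.

Definition E_minus (E : set W) (s : W) : set W :=
  [set w | [/\ E w, (len (s * w)%g < len w)%N & E (s * w)%g]].
Definition E_plus (E : set W) (s : W) : set W :=
  [set w | [/\ E w, (len w < len (s * w)%g)%N & E (s * w)%g]].
Definition E_zero_minus (J E : set W) (s : W) : set W :=
  [set w | [/\ E w, (len w < len (s * w)%g)%N & ~ D_set J (s * w)%g]].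
Definition E_zero_plus (J E : set W) (s : W) : set W :=
  [set w | [/\ E w, (len w < len (s * w)%g)%N, D_set J (s * w)%g
             & ~ E (s * w)%g]].

Definition eps (A : pzRingType) (w : W) : A := (-1) ^+ len w.
End Coxeter.

(* Modules over an A-algebra H are seen as A-modules through a |-> a%:A. *)
Section Bases.
Variables (A : comNzRingType) (H : algType A) (W : choiceType).

Definition ascale (M : lmodType H) (a : A) (m : M) : M := (a%:A : H) *: m.

Definition lincomb (M : lmodType H) (D : set W) (b : W -> M) (c : W -> A) : M :=
  \sum_(w \in D) ascale (c w) (b w).

(* m = sum_(w in D) c w b w, a finite sum: c has finite support in D. (For
   infinite supports the sum in [lincomb] would be 0 by convention.) *)
Definition expansion (M : lmodType H) (D : set W) (b : W -> M) (m : M)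
    (c : W -> A) : Prop :=
  finite_set (D `&` [set w | c w != 0]) /\ m = lincomb D b c.

Definition is_basis (M : lmodType H) (D : set W) (b : W -> M) : Prop :=
  (forall m, exists c, expansion D b m c) /\
  (forall c, expansion D b 0 c -> forall w, D w -> c w = 0).
End Bases.

Section Hecke.
Variables (R : comNzRingType) (G : orderedGroupType).
Variables (W : groupType) (S : set W) (L : W -> G).
Notation A := (groupAlg R G).
Notation ell := (len S).
Notation q := (@qpow R G).
Notation "a •: m" := (ascale (a : A) m) (at level 40).

Variables (H : algType A).

(* In H^o, H acts on itself by left multiplication, so that ascale a h = a *: h. *)
Record hecke_algebra (T : W -> H) : Prop := {
  hecke_basis : @is_basis A H W (H^o) [set: W] T;
  hecke_one : T 1%g = 1;
  hecke_up : forall s w, S s -> (ell w < ell (s * w)%g)%N ->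
    T s * T w = T (s * w)%g;
  hecke_down : forall s w, S s -> (ell (s * w)%g < ell w)%N ->
    T s * T w = T (s * w)%g + (q (L s) - q (- L s)) *: T w
}.

(* The last two fields say that barH (T w) is the inverse of T (w^-1). *)
Record hecke_bar (T : W -> H) (barH : {rmorphism H -> H}) : Prop := {
  hbar_invol : involutive barH;
  hbar_scale : forall (a : A) h, barH (a *: h) = gbar a *: barH h;
  hbar_left : forall w, barH (T w) * T (w^-1)%g = 1;
  hbar_right : forall w, T (w^-1)%g * barH (T w) = 1
}.

Record hecke_phi (T : W -> H) (barH : {rmorphism H -> H})
    (Phi : {lrmorphism H -> H}) : Prop := {
  phi_invol : involutive Phi;
  phi_T : forall w, Phi (T w) = eps S A w *: barH (T w)
}.

Record module_bar (barH : {rmorphism H -> H}) (M : lmodType H) (m1 : M)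
    (barM : M -> M) : Prop := {
  mbar_add : forall m n, barM (m + n) = barM m + barM n;
  mbar_scale : forall (a : A) m, barM (a •: m) = gbar a •: barM m;
  mbar_invol : involutive barM;
  mbar_one : barM m1 = m1;
  mbar_act : forall h m, barM (h *: m) = barH h *: barM m
}.

Definition below (E : set W) (w : W) : set W :=
  [set z | E z /\ bruhat_lt S z w].

Record ideal_module (T : W -> H) (J E : set W) (M : lmodType H)
    (Gam : W -> M) (r : W -> W -> W -> A) : Prop := {
  im_basis : is_basis E Gam;
  im_r : forall s z w, S s -> E_zero_plus S J E s w -> below E w z ->
    exists2 a, A_gt0 a & r s z w = q (L s) * a;
  im_minus : forall s w, S s -> E_minus S E s w ->
    T s *: Gam w = Gam (s * w)%g + (q (L s) - q (- L s)) •: Gam w;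
  im_plus : forall s w, S s -> E_plus S E s w ->
    T s *: Gam w = Gam (s * w)%g;
  im_zero_minus : forall s w, S s -> E_zero_minus S J E s w ->
    T s *: Gam w = - (q (- L s) •: Gam w);
  im_zero_plus : forall s w, S s -> E_zero_plus S J E s w ->
    exists2 m, expansion (below E w) Gam m (fun z => r s z w) &
    T s *: Gam w = q (L s) •: Gam w - m
}.

Record wgraph_ideal (T : W -> H) (barH : {rmorphism H -> H}) (J E : set W)
    (M : lmodType H) (Gam : W -> M) (r : W -> W -> W -> A) (barM : M -> M)
    : Prop := {
  wgi_ideal : weak_order_ideal S E;
  wgi_one : E 1%g;
  wgi_sub : E `<=` D_set S J;
  wgi_module : ideal_module T J E Gam r;
  wgi_bar : module_bar barH (Gam 1%g) barM
}.

Record dual_module (T : W -> H) (barH : {rmorphism H -> H}) (J E : set W)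
    (r : W -> W -> W -> A) (Mt : lmodType H) (Gamt : W -> Mt)
    (barMt : Mt -> Mt) : Prop := {
  dm_basis : is_basis E Gamt;
  dm_minus : forall s w, S s -> E_minus S E s w ->
    T s *: Gamt w = Gamt (s * w)%g + (q (L s) - q (- L s)) •: Gamt w;
  dm_plus : forall s w, S s -> E_plus S E s w ->
    T s *: Gamt w = Gamt (s * w)%g;
  dm_zero_minus : forall s w, S s -> E_zero_minus S J E s w ->
    T s *: Gamt w = q (L s) •: Gamt w;
  dm_zero_plus : forall s w, S s -> E_zero_plus S J E s w ->
    exists2 m, expansion (below E w) Gamt m
                 (fun z => eps S A z * eps S A w * gbar (r s z w)) &
    T s *: Gamt w = - (q (- L s) •: Gamt w) + m;
  dm_bar : module_bar barH (Gamt 1%g) barMt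
}.

Record duality_map (Phi : {lrmorphism H -> H}) (M Mt : lmodType H)
    (Gam : W -> M) (Gamt : W -> Mt) (eta : M -> Mt) : Prop := {
  eta_one : eta (Gam 1%g) = Gamt 1%g;
  eta_act : forall h m, eta (h *: m) = Phi h *: eta m
}.

Definition R_polynomials (E : set W) (Mt : lmodType H) (Gamt : W -> Mt)
    (barMt : Mt -> Mt) (Rt : W -> W -> A) : Prop :=
  forall y, E y -> expansion E Gamt (barMt (Gamt y)) (fun x => Rt x y).

Record KL_coefficients (E : set W) (P : W -> W -> A) : Prop := {
  klc_ge0 : forall y w, E y -> E w -> A_ge0 (P y w);
  klc_zero : forall y w, E y -> E w -> ~ bruhat_le S y w -> P y w = 0;
  klc_one : forall w, E w -> P w w = 1;
  klc_const : forall y w, E y -> E w -> y <> w -> const_term (P y w) = 0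
}.

Record KL_basis (E : set W) (M : lmodType H) (Gam : W -> M) (barM : M -> M)
    (C : W -> M) (P : W -> W -> A) : Prop := {
  kl_bar : forall w, E w -> barM (C w) = C w;
  kl_expansion : forall w, E w -> expansion E Gam (C w) (fun y => P y w);
  kl_coeffs : KL_coefficients E P
}.

Record dual_KL_basis (E : set W) (M : lmodType H) (Gam : W -> M)
    (barM : M -> M) (Rt : W -> W -> A) (B : W -> M) (P : W -> W -> A)
    : Prop := {
  dkl_basis : is_basis E B;
  dkl_bar : forall w, E w -> barM (B w) = B w;
  dkl_expansion : forall w, E w ->
    expansion E Gam (B w) (fun y => eps S A y * gbar (P y w));
  dkl_coeffs : KL_coefficients E P;
  dkl_rec : forall y w, E y -> E w -> bruhat_lt S y w ->
    gbar (P y w) - P y w =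
    \sum_(x \in [set x | [/\ E x, bruhat_lt S y x & bruhat_le S x w]])
       gbar (Rt y x) * P x w
}.
End Hecke.

(* Main.v *)
Require Import Defs.
From mathcomp Require Import all_boot all_order all_algebra.
From mathcomp Require Import finmap.
From mathcomp Require Import boolp classical_sets functions cardinality fsbigop.
From mathcomp Require Import reals.
From mathcomp.real_closed Require Import complex.
From mathcomp.multinomials Require Import monalg.
From Stdlib Require Import Relations.

(** Why the theorem is true.

    Every standard basis vector is Gamma_w = T_w Gamma_1, because the ideal E
    is closed under removing left descents ([standard_cyclic]); the same holds
    in the dual module.  Since Phi (T_w) is eps_w times the bar of T_w, the
    duality map sends the bar of Gamma_w to eps_w Gamma~_w.  Hence, if m has
    coefficients c in the basis Gamma, then eta sends the bar of m to the vector
    with coefficients eps_y * gbar (c y) in the basis Gamma~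
    ([duality_bar_expansion]), and eta commutes with the two bar involutions
    ([duality_bar_commute]).  As C_w is bar invariant, this is the expansion
    asserted in (b).  The inverse theta of eta is itself a duality map
    ([duality_map_inv]), so the same argument gives the expansion and the bar
    invariance asserted in (a).  Both families are triangular for the length
    with diagonal entries eps_w, so they are bases ([unitriangular_basis]).

    For the recursion, comparing coefficients in bar (C~_w) = C~_w gives
    P~_{y,w} = sum_x R~_{y,x} gbar (P~_{x,w}).  Read as an equation for R~, this
    identity shows by induction on the length of w that R~ is unitriangular for
    the Bruhat order ([R_unitriangular]); no computation with the action of the
    generators is involved.  Applying gbar and splitting off the term x = y
    yields the recursion ([KL_recursion]).

    For the uniqueness, the recursion determines gbar (P_{y,w}) - P_{y,w} from
    the P_{x,w} with x > y, and an element a of A_{>= 0} without constant term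
    is determined by gbar a - a, since a and gbar a have disjoint supports
    ([A_gt0_bar_fixed]).  So descending induction on y shows that the recursion
    has at most one solution ([KL_coefficients_uniq]), and a basis as in (a) is
    determined by its coefficients. *)

Set Implicit Arguments.
Unset Strict Implicit.
Unset Printing Implicit Defensive.

Import Order.TTheory GRing.Theory Num.Theory.

Local Open Scope classical_set_scope.
Local Open Scope ring_scope.

(** * Coefficients of vectors in a family indexed by a set *)

Section Expansions.
Variables (A : comNzRingType) (H : algType A) (W : choiceType) (M : lmodType H).
Implicit Types (m n : M) (a : A) (D : set W) (b : W -> M) (c : W -> A).

Lemma ascaleDr a m n : ascale a (m + n) = ascale a m + ascale a n.
Proof. exact: scalerDr. Qed.

Lemma ascaleDl a a' m : ascale (a + a') m = ascale a m + ascale a' m.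
Proof. by rewrite /ascale scalerDl scalerDl. Qed.

Lemma ascaleA a a' m : ascale a (ascale a' m) = ascale (a * a') m.
Proof. by rewrite /ascale scalerA -scalerAl mul1r scalerA. Qed.

Lemma ascale1 m : ascale 1 m = m.
Proof. by rewrite /ascale !scale1r. Qed.

Lemma ascale0 m : ascale 0 m = 0.
Proof. by rewrite /ascale !scale0r. Qed.

Lemma ascaleN1 m : ascale (-1) m = - m.
Proof. by rewrite /ascale !scaleN1r. Qed.

Lemma ascale_sumr I (s : seq I) (F : I -> M) a :
  ascale a (\sum_(i <- s) F i) = \sum_(i <- s) ascale a (F i).
Proof. exact: scaler_sumr. Qed.

Lemma ascaleC (h : H) a m : h *: ascale a m = ascale a (h *: m).
Proof. by rewrite /ascale !scalerA mulr_algr mulr_algl. Qed.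

(** Sums over a set of indices are inconvenient to combine, since they vanish
    by convention when the support is infinite.  A list that carries the
    coefficients turns an expansion into an ordinary finite sum. *)
Definition carries D (s : seq W) c : Prop :=
  [/\ uniq s, forall w, w \in s -> D w & forall w, D w -> w \notin s -> c w = 0].

Lemma carries_undup_cat D s1 s2 c1 c2 c : carries D s1 c1 -> carries D s2 c2 ->
  (forall w, c1 w = 0 -> c2 w = 0 -> c w = 0) ->
  carries D (undup (s1 ++ s2)) c.
Proof.
move=> [_ D1 z1] [_ D2 z2] cP; split=> [|w|w Dw]; first exact: undup_uniq.
  by rewrite mem_undup mem_cat => /orP[/D1|/D2].
by rewrite mem_undup mem_cat negb_or => /andP[/z1 e1 /z2 e2]; apply: cP; auto.
Qed.

Lemma expansion_carried D s b m c : carries D s c ->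
  expansion D b m c <-> m = \sum_(w <- s) ascale (c w) (b w).
Proof.
move=> [us sD s0].
have lcE : lincomb D b c = \sum_(w <- s) ascale (c w) (b w).
  rewrite /lincomb (fsbigE s) // => [|w Dw /(s0 _ Dw) ->]; last exact: ascale0.
  rewrite big_seq_cond [RHS]big_seq; apply: eq_bigl => w.
  by case: (boolP (w \in s)) => //= /sD Dw; rewrite mem_set.
split=> [[_ ->] //|->]; split=> //.
apply: (@sub_finite_set _ _ [set` s]); last exact: finite_seq.
move=> w [Dw /= cw]; apply/negPn/negP => /(s0 _ Dw) c0.
by rewrite c0 eqxx in cw.
Qed.

Lemma expansion_carrier D b m c : expansion D b m c -> exists s, carries D s c.
Proof.
move=> [fc _]; exists (fset_set (D `&` [set w | c w != 0])).
split=> [|w|w Dw]; first exact: fset_uniq.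
  by rewrite in_fset_set // inE => -[].
rewrite in_fset_set // notin_setE /= => ncw; apply/eqP/negPn/negP => cw.
exact: ncw.
Qed.

Lemma eq_expansion D b m c c' : (forall w, D w -> c w = c' w) ->
  expansion D b m c -> expansion D b m c'.
Proof.
move=> ecc' ex; have [s [us sD s0]] := expansion_carrier ex.
move: ex => /(@expansion_carried _ s) ->; last by split.
apply/(@expansion_carried _ s); first by split=> // w Dw /(s0 _ Dw); rewrite ecc'.
by rewrite [LHS]big_seq [RHS]big_seq; apply: eq_bigr => w /sD /ecc' ->.
Qed.

Lemma expansion0 D b : expansion D b 0 (fun=> 0).
Proof. by apply/(@expansion_carried _ [::]); [split | rewrite big_nil]. Qed.

Lemma expansionD D b m n c c' : expansion D b m c -> expansion D b n c' ->
  expansion D b (m + n) (fun w => c w + c' w).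
Proof.
move=> ex ex'; have [s cs] := expansion_carrier ex.
have [s' cs'] := expansion_carrier ex'.
have cP (d : W -> A) : (forall w, c w = 0 -> c' w = 0 -> d w = 0) ->
  carries D (undup (s ++ s')) d by exact: carries_undup_cat.
move: ex => /(expansion_carried _ _ (cP _ _)) -> //.
move: ex' => /(expansion_carried _ _ (cP _ _)) -> //.
apply/(expansion_carried _ _ (cP _ _)) => [w -> ->|]; first by rewrite addr0.
by rewrite -big_split; apply: eq_bigr => w _; rewrite ascaleDl.
Qed.

Lemma expansionZ D b m c a : expansion D b m c ->
  expansion D b (ascale a m) (fun w => a * c w).
Proof.
move=> ex; have [s cs] := expansion_carrier ex; have [us sD s0] := cs.
move: ex => /(expansion_carried _ _ cs) ->.
apply/(@expansion_carried _ s); first by split=> // w Dw /(s0 _ Dw) ->; rewrite mulr0.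
by rewrite ascale_sumr; apply: eq_bigr => w _; rewrite ascaleA.
Qed.

Lemma expansion_sum (I : eqType) (s : seq I) D b (f : I -> M) (a : I -> A)
    (c : I -> W -> A) :
  (forall i, i \in s -> expansion D b (f i) (c i)) ->
  expansion D b (\sum_(i <- s) ascale (a i) (f i))
    (fun w => \sum_(i <- s) a i * c i w).
Proof.
elim: s => [|i s IHs] ex.
  rewrite big_nil; apply: eq_expansion (expansion0 D b) => w _.
  by rewrite big_nil.
rewrite big_cons.
apply: eq_expansion (expansionD (expansionZ (a i) (ex i _)) (IHs _)).
- by move=> w _; rewrite big_cons.
- exact: mem_head.
- by move=> j js; apply: ex; rewrite inE js orbT.
Qed.

Lemma expansion_self D b w : D w -> expansion D b (b w) (fun y => (y == w)%:R).
Proof.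
move=> Dw; apply/(@expansion_carried _ [:: w]).
  split=> // [v|v _]; first by rewrite inE => /eqP ->.
  by rewrite inE => /negPf ->.
by rewrite big_seq1 eqxx ascale1.
Qed.

Lemma expansion_uniq D b m c c' : is_basis D b ->
  expansion D b m c -> expansion D b m c' -> forall w, D w -> c w = c' w.
Proof.
move=> [_ free] ex /(expansionZ (-1)) /(expansionD ex) ex0 w Dw.
rewrite ascaleN1 subrr in ex0.
by move: (free _ ex0 _ Dw); rewrite mulN1r => /eqP; rewrite subr_eq0 => /eqP.
Qed.

Lemma expansion_fun D b m n c :
  expansion D b m c -> expansion D b n c -> m = n.
Proof. by move=> [_ ->] [_ ->]. Qed.

(** The diagonal entries are units rather than 1 to allow for the signs eps_w
    produced by the duality maps. *)
Definition unitriangular D (ht : W -> nat) (Q : W -> W -> A) : Prop :=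
  (forall w, D w -> exists u, u * Q w w = 1) /\
  (forall y w, D y -> D w -> y <> w -> (ht w <= ht y)%N -> Q y w = 0).

(** Spanning: the equation for b' w can be solved for b w modulo vectors b y of
    smaller height, so induction on the height applies.  Independence: in a
    relation among the b', the coordinate at an index y of maximal height among
    those with non-zero coefficient only sees the diagonal entry at y.  Both
    inductions stop because every single expansion has finite support. *)
Lemma unitriangular_basis D ht b b' (Q : W -> W -> A) :
  unitriangular D ht Q -> is_basis D b ->
  (forall w, D w -> expansion D b (b' w) (fun y => Q y w)) -> is_basis D b'.
Proof.
move=> [unitQ triQ] bb ex; split=> [m|c ex0].
  have span_b w : D w -> exists c, expansion D b' (b w) c.
    have [k] := ubnP (ht w); elim: k w => // k IHk w wk Dw.
    have [u uQ] := unitQ w Dw.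
    have [s cs] := expansion_carrier (ex w Dw); have [us sD s0] := cs.
    have /(expansion_carried _ _ cs) b'E := ex w Dw.
    have ws : w \in s.
      apply/negPn/negP => /(s0 _ Dw) Q0; move/eqP: uQ.
      by rewrite Q0 mulr0 eq_sym oner_eq0.
    have bE : b w =
        ascale u (b' w) + ascale (- u) (\sum_(y <- rem w s) ascale (Q y w) (b y)).
      rewrite b'E (big_rem w ws) /= ascaleDr ascaleA uQ ascale1 -addrA.
      by rewrite -ascaleDl subrr ascale0 addr0.
    (* Totalized over y, so that the expansions can be chosen simultaneously. *)
    have IH y : exists c, y \in rem w s -> Q y w != 0 -> expansion D b' (b y) c.
      have [Q0|Qn0] := eqVneq (Q y w) 0; first by exists (fun=> 0).
      have [yr|] := boolP (y \in rem w s); last by exists (fun=> 0).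
      move: yr; rewrite mem_rem_uniq // inE => /andP[/eqP yw /sD Dy].
      have yk : (ht y < k)%N.
        rewrite ltnS in wk; apply: leq_trans wk; rewrite ltnNge.
        by apply/negP => /(triQ _ _ Dy Dw yw) Q0; rewrite Q0 eqxx in Qn0.
      by have [c ec] := IHk y yk Dy; exists c.
    have [f fP] := choice IH.
    exists (fun v => u * (v == w)%:R +
                     - u * \sum_(y <- rem w s) Q y w *
                             (if Q y w == 0 then 0 else f y v)).
    rewrite bE; apply: expansionD (expansionZ _ (expansion_self _ Dw)) _.
    apply: expansionZ.
    have -> : \sum_(y <- rem w s) ascale (Q y w) (b y) =
        \sum_(y <- rem w s) ascale (Q y w) (if Q y w == 0 then 0 else b y).
      by apply: eq_bigr => y _; case: eqP => // ->; rewrite !ascale0.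
    apply: expansion_sum => y yr.
    have [_|Qn0] := eqVneq (Q y w) 0; first exact: expansion0.
    exact: fP.
  have [c ec] := bb.1 m.
  have [s cs] := expansion_carrier ec; have [_ sD _] := cs.
  move: ec => /(expansion_carried _ _ cs) ->.
  have IH w : exists d, D w -> expansion D b' (b w) d.
    have [Dw|] := pselect (D w); last by exists (fun=> 0).
    by have [d] := span_b w Dw; exists d.
  have [f fP] := choice IH.
  exists (fun v => \sum_(w <- s) c w * f w v).
  by apply: expansion_sum => w /sD; exact: fP.
have [s cs] := expansion_carrier ex0; have [us sD s0] := cs.
move: ex0 => /(expansion_carried _ _ cs) sum0.
have coord0 y : D y -> \sum_(w <- s) c w * Q y w = 0.
  move=> Dy.
  apply: (expansion_uniq (c := fun v => \sum_(w <- s) c w * Q v w) bb _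
            (expansion0 D b) Dy).
  by rewrite sum0; apply: expansion_sum => w /sD; exact: ex.
pose N := \max_(w <- s) ht w.
suff top k y : D y -> (N < ht y + k)%N -> c y = 0.
  by move=> y Dy; apply: (top N.+1) => //; rewrite addnS ltnS leq_addl.
elim: k y => [|k IHk] y Dy Nk; have [ys|/(s0 _ Dy) //] := boolP (y \in s).
  by move: Nk; rewrite addn0 ltnNge (leq_bigmax_seq _ ys).
have := coord0 y Dy; rewrite (big_rem y ys) /= big_seq big1 ?addr0 => [|w].
  have [u uQ] := unitQ y Dy.
  by move=> cQ; rewrite -[c y]mulr1 -uQ mulrCA cQ mulr0.
rewrite mem_rem_uniq // inE => /andP[/eqP wy /sD Dw].
have [le_wy|lt_yw] := leqP (ht w) (ht y); first by rewrite triQ ?mulr0 // => /esym.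
rewrite (IHk w) ?mul0r //; apply: leq_trans Nk _.
by rewrite addnS -addSn leq_add2r.
Qed.

End Expansions.

(** * The bar involution of the group algebra *)

Section BarInvolution.
Variables (R : comNzRingType) (G : zmodType).
Notation A := (groupAlg R G).
Implicit Types a b : A.

Lemma groupAlgP a b : (forall g, a@_g = b@_g) -> a = b.
Proof. by move=> /malgP. Qed.

Lemma gbarK : involutive (@gbar R G).
Proof. by move=> a; apply: groupAlgP => g; rewrite !gbar_coeff opprK. Qed.

Lemma gbarD a b : gbar (a + b) = gbar a + gbar b.
Proof. by apply: groupAlgP => g; rewrite mcoeffD !gbar_coeff mcoeffD. Qed.

Lemma gbar0 : gbar (0 : A) = 0.
Proof. by apply: groupAlgP => g; rewrite gbar_coeff !mcoeff0. Qed.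

Lemma gbarN a : gbar (- a) = - gbar a.
Proof. by apply: groupAlgP => g; rewrite mcoeffN !gbar_coeff mcoeffN. Qed.

Lemma gbar_sum I (s : seq I) (F : I -> A) :
  gbar (\sum_(i <- s) F i) = \sum_(i <- s) gbar (F i).
Proof. exact: (big_morph _ gbarD gbar0). Qed.

Lemma gbarU (x : R) (g : G) : gbar (<< x *g g >> : A) = << x *g - g >>.
Proof. by apply: groupAlgP => h; rewrite gbar_coeff !mcoeffU eqr_oppLR. Qed.

Lemma gbarM a b : gbar (a * b) = gbar a * gbar b.
Proof.
rewrite [RHS](_ : _ = ga_mul (gbar a) (gbar b)) // [gbar a]/gbar [gbar b]/gbar.
rewrite ga_mul_suml [a * b]/(ga_mul a b) gbar_sum; apply: eq_bigr => g _.
rewrite gbar_sum ga_mul_sumr; apply: eq_bigr => h _.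
by rewrite gbarU ga_mulUU opprD.
Qed.

Lemma gbar1 : gbar (1 : A) = 1.
Proof. by rewrite [LHS]gbarU oppr0. Qed.

Lemma gbar_sign n : gbar ((-1) ^+ n : A) = (-1) ^+ n.
Proof.
elim: n => [|n IHn]; first exact: gbar1.
by rewrite !exprS gbarM gbarN gbar1 IHn.
Qed.
End BarInvolution.

(** * Length, left descents and Bruhat order *)

Section Length.
Variables (W : groupType) (S : set W).
Notation ell := (len S).

Lemma len_le_size w u : is_word S w u -> (ell w <= size u)%N.
Proof.
move=> wu; rewrite /len; case: pselect => // ex; case: ex_minnP => n _; apply.
by apply/asboolP; exists u.
Qed.

Lemma reduced_word w : coxeter_system S -> exists u, is_reduced S w u.
Proof.
move=> [m [_ /(_ w) [u wu] _ _]]; rewrite /is_reduced /len.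
have ex : exists n, `[< exists2 u, is_word S w u & size u = n >].
  by exists (size u); apply/asboolP; exists u.
case: pselect => // ex'; case: ex_minnP => n /asboolP[v wv vn] _.
by exists v.
Qed.

Lemma is_word_cat x y u v :
  is_word S x u -> is_word S y v -> is_word S (x * y)%g (u ++ v).
Proof.
move=> [uS ->] [vS ->]; split; last by rewrite big_cat.
by move=> s; rewrite mem_cat => /orP[/uS|/vS].
Qed.

(** The first letter s of a reduced word of w splits off: the length of s v is
    at most the sum of the lengths, which is at most the length of w. *)
Lemma left_descent w : coxeter_system S -> w <> 1%g ->
  exists s v, [/\ S s, w = (s * v)%g, (ell v < ell w)%N & left_weak_le S v w].
Proof.
move=> hW w1; have [[|s u] [[uS wE] uw]] := reduced_word w hW.
  by case: w1; rewrite wE big_nil.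
rewrite big_cons in wE; exists s, (\prod_(t <- u) t)%g.
have Ss : S s by apply: uS; exact: mem_head.
have wu : is_word S (\prod_(t <- u) t)%g u.
  by split=> // t tu; apply: uS; rewrite inE tu orbT.
have ws : is_word S s [:: s].
  by split; [move=> t; rewrite inE => /eqP -> | rewrite big_seq1].
have le_v := len_le_size wu; have le_s := len_le_size ws.
split=> //; first by rewrite -uw ltnS.
exists s; split=> //; apply/eqP; rewrite eqn_leq; apply/andP; split; last first.
  by rewrite -uw /= -add1n leq_add.
have [a [wa <-]] := reduced_word s hW.
have [b [wb <-]] := reduced_word (\prod_(t <- u) t)%g hW.
by rewrite -size_cat wE; apply/len_le_size/is_word_cat.
Qed.

Lemma bruhat_le_len x y : bruhat_le S x y -> x = y \/ (ell x < ell y)%N.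
Proof.
elim=> {x y} [x y [_ lxy]|x|x y z _ [->|lxy] _ [<-|lyz]]; [by right|by left|..].
- by left.
- by right.
- by right.
- by right; apply: ltn_trans lyz.
Qed.

Lemma bruhat_lt_len x y : bruhat_lt S x y -> (ell x < ell y)%N.
Proof. by move=> [/bruhat_le_len[->|] ]. Qed.

Lemma bruhat_le_trans x y z : bruhat_le S x y -> bruhat_le S y z -> bruhat_le S x z.
Proof. exact: rt_trans. Qed.

(** An ideal of the left weak order is reached from 1 by steps v |-> s v that
    increase the length and stay inside the ideal. *)
Lemma weak_ideal_ind (E : set W) (Q : W -> Prop) :
  coxeter_system S -> weak_order_ideal S E -> Q 1%g ->
  (forall s v, S s -> E_plus S E s v -> Q v -> Q (s * v)%g) ->
  forall w, E w -> Q w.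
Proof.
move=> hW Eid Q1 Qs w; have [k] := ubnP (ell w); elim: k w => // k IHk w wk Ew.
have [->//|w1] := pselect (w = 1%g).
have [s [v [Ss wE vw /(Eid _ _ Ew) Ev]]] := left_descent hW w1.
rewrite wE; apply: Qs => //; first by split; rewrite -?wE.
by apply: IHk => //; apply: leq_trans vw _; rewrite -ltnS.
Qed.
End Length.

(** * The duality maps and the bar involutions *)

Section Duality.
Variables (R : comNzRingType) (G : orderedGroupType) (W : groupType) (S : set W).
Variables (L : W -> G) (H : algType (groupAlg R G)) (T : W -> H).
Variables (barH : {rmorphism H -> H}) (Phi : {lrmorphism H -> H}).
Hypotheses (hW : coxeter_system S) (hH : hecke_algebra S L T).
Hypotheses (hbarH : hecke_bar T barH) (hPhi : hecke_phi S T barH Phi).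
Notation A := (groupAlg R G).
Notation eps := (eps S A).
Implicit Types (M N : lmodType H) (E : set W).

Lemma eps_sq w : eps w * eps w = 1.
Proof. by rewrite /Defs.eps -exprD addnn -mul2n exprM sqrrN expr1n expr1n. Qed.

Lemma gbar_eps w : gbar (eps w) = eps w.
Proof. exact: gbar_sign. Qed.

Lemma phi_bar_T w : Phi (barH (T w)) = eps w *: T w.
Proof.
have := congr1 ( *:%R (eps w)) (phi_invol hPhi (T w)).
by rewrite (phi_T hPhi) linearZ /= scalerA eps_sq scale1r.
Qed.

Lemma bar_phi_T w : barH (Phi (T w)) = eps w *: T w.
Proof.
by rewrite (phi_T hPhi) (hbar_scale hbarH) gbar_eps (hbar_invol hbarH).
Qed.

Lemma standard_cyclic M E (Gam : W -> M) : weak_order_ideal S E ->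
  (forall s w, S s -> E_plus S E s w -> T s *: Gam w = Gam (s * w)%g) ->
  forall w, E w -> Gam w = T w *: Gam 1%g.
Proof.
move=> Eid Gs; apply: (weak_ideal_ind hW Eid).
  by rewrite (hecke_one hH) scale1r.
move=> s v Ss Ev IH; rewrite -(Gs _ _ Ss Ev) IH scalerA.
by case: Ev => _ lv _; rewrite (hecke_up hH).
Qed.

Lemma ascale_act M (a : A) (h : H) (m : M) : ascale a (h *: m) = (a *: h) *: m.
Proof. by rewrite /ascale scalerA mulr_algl. Qed.

(** Phi is an involution, so the two modules play symmetric roles. *)
Lemma duality_map_inv M N (Gam : W -> M) (Gan : W -> N) (eta : M -> N)
    (theta : N -> M) : cancel eta theta -> cancel theta eta ->
  duality_map Phi Gam Gan eta -> duality_map Phi Gan Gam theta.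
Proof.
move=> etaK thetaK [eta1 etaM]; split; first by rewrite -eta1 etaK.
move=> h n; apply: (can_inj etaK).
by rewrite thetaK etaM (phi_invol hPhi) thetaK.
Qed.

Variables (M N : lmodType H) (E : set W) (Gam : W -> M) (Gan : W -> N).
Variables (barM : M -> M) (barN : N -> N) (eta : M -> N).
Hypotheses (GamE : forall w, E w -> Gam w = T w *: Gam 1%g).
Hypotheses (GanE : forall w, E w -> Gan w = T w *: Gan 1%g).
Hypotheses (hM : module_bar barH (Gam 1%g) barM).
Hypotheses (hN : module_bar barH (Gan 1%g) barN).
Hypothesis heta : duality_map Phi Gam Gan eta.

(** Linearity of eta is not part of the definition of a duality map.  Writing a
    vector as a single h *: Gam 1 lets eta be computed from its action rule. *)
Lemma expansion_cyclic m c : expansion E Gam m c ->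
  exists2 s, carries E s c & m = (\sum_(w <- s) c w *: T w) *: Gam 1%g.
Proof.
move=> ex; have [s cs] := expansion_carrier ex; exists s => //.
move: ex => /(expansion_carried _ _ cs) ->; have [_ sE _] := cs.
rewrite scaler_suml !big_seq; apply: eq_bigr => w /sE Ew.
by rewrite (GamE Ew) ascale_act.
Qed.

(** The bar of T_w Gam_1 is barH (T_w) Gam_1, which eta sends to
    Phi (barH (T_w)) Gan_1 = eps_w T_w Gan_1. *)
Lemma duality_bar_expansion m c : expansion E Gam m c ->
  expansion E Gan (eta (barM m)) (fun y => eps y * gbar (c y)).
Proof.
move=> /expansion_cyclic [s [us sE s0] ->].
apply/(@expansion_carried _ _ _ _ _ s).
  by split=> // w Ew /(s0 _ Ew) ->; rewrite gbar0 mulr0.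
rewrite (mbar_act hM) (mbar_one hM) (eta_act heta) (eta_one heta).
rewrite !raddf_sum /= scaler_suml !big_seq; apply: eq_bigr => w /sE Ew.
rewrite (hbar_scale hbarH) linearZ /= phi_bar_T (GanE Ew) ascale_act scalerA.
by rewrite mulrC.
Qed.

(** Phi and barH commute on each T_w: both composites give eps_w T_w. *)
Lemma duality_bar_commute m c : expansion E Gam m c ->
  barN (eta m) = eta (barM m).
Proof.
move=> /expansion_cyclic [s _ ->].
rewrite (mbar_act hM) (mbar_one hM) !(eta_act heta) (eta_one heta).
rewrite (mbar_act hN) (mbar_one hN); congr (_ *: _).
rewrite !raddf_sum /=; apply: eq_bigr => w _.
rewrite (hbar_scale hbarH) !linearZ /= (hbar_scale hbarH).
by rewrite bar_phi_T phi_bar_T.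
Qed.
End Duality.

(** * Recursion and uniqueness for Kazhdan-Lusztig coefficients *)

Section KazhdanLusztig.
Variables (R : comNzRingType) (G : orderedGroupType) (W : groupType) (S : set W).
Notation A := (groupAlg R G).
Notation ell := (len S).
Notation eps := (eps S A).
Variables (H : algType A) (barH : {rmorphism H -> H}).
Implicit Types (M : lmodType H) (E : set W) (P Q Rt : W -> W -> A).

Lemma bar_fixed_coefficients M E (Gam : W -> M) (barM : M -> M) m1 Rt s m c :
  is_basis E Gam -> module_bar barH m1 barM -> R_polynomials E Gam barM Rt ->
  expansion E Gam m c -> carries E s c -> barM m = m ->
  forall y, E y -> c y = \sum_(x <- s) gbar (c x) * Rt y x.
Proof.
move=> bG hM hR ex cs bm y Ey; have [us sE s0] := cs.
apply: (expansion_uniq (c' := fun v => \sum_(x <- s) gbar (c x) * Rt v x)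
          bG ex _ Ey).
have bar0 : barM 0 = 0.
  by move: (mbar_act hM 0 0); rewrite rmorph0 !scale0r.
have -> : m = \sum_(x <- s) ascale (gbar (c x)) (barM (Gam x)).
  move: ex => /(expansion_carried _ _ cs) mE.
  rewrite -[LHS]bm mE (big_morph barM (mbar_add hM) bar0).
  by apply: eq_bigr => x _; rewrite (mbar_scale hM).
by apply: expansion_sum => x /sE Ex; exact: hR.
Qed.

Lemma KL_carrier_mem E P w s : KL_coefficients S E P ->
  E w -> carries E s (fun y => P y w) -> w \in s.
Proof.
move=> hP Ew [_ _ s0]; apply/negPn/negP => /(s0 _ Ew).
by rewrite (klc_one hP Ew) => /eqP; rewrite oner_eq0.
Qed.

(** In P_{y,w} = sum_x gbar (P_{x,w}) R_{y,x} the term x = w is R_{y,w}, and all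
    other terms have x < w.  If y is not below w, or if y = w, then y is not
    below any such x, so induction leaves R_{y,w} = P_{y,w}. *)
Lemma R_unitriangular M E (Gam : W -> M) (barM : M -> M) m1 Rt C P :
  is_basis E Gam -> module_bar barH m1 barM -> R_polynomials E Gam barM Rt ->
  KL_basis S E Gam barM C P ->
  forall w, E w -> Rt w w = 1 /\
    forall y, E y -> ~ bruhat_le S y w -> Rt y w = 0.
Proof.
move=> bG hM hR [Cbar Cex hP] w; have [k] := ubnP (ell w).
elim: k w => // k IHk w wk Ew; rewrite ltnS in wk.
have [s cs] := expansion_carrier (Cex w Ew); have [us sE _] := cs.
have ws := KL_carrier_mem hP Ew cs.
have RE y : E y -> (forall x, E x -> bruhat_lt S x w -> Rt y x = 0) ->
    Rt y w = P y w.
  move=> Ey R0; rewrite (bar_fixed_coefficients bG hM hR (Cex w Ew) cs (Cbar w Ew)) //.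
  rewrite (big_rem w ws) /= (klc_one hP Ew) gbar1 mul1r big_seq big1 ?addr0 //.
  move=> x; rewrite mem_rem_uniq // inE => /andP[/eqP xw /sE Ex].
  have [le_xw|/(klc_zero hP Ex Ew) ->] := pselect (bruhat_le S x w).
    by rewrite (R0 x) ?mulr0.
  by rewrite gbar0 mul0r.
have lower x : E x -> bruhat_lt S x w ->
    forall y, E y -> ~ bruhat_le S y x -> Rt y x = 0.
  move=> Ex xw; apply: (IHk x _ Ex).2.
  exact: leq_trans (bruhat_lt_len xw) wk.
split=> [|y Ey yw].
  rewrite RE ?(klc_one hP) // => x Ex xw; apply: lower => // /bruhat_le_len.
  have lx := bruhat_lt_len xw; case=> [wx|lw]; first by rewrite wx ltnn in lx.
  by have := ltn_trans lx lw; rewrite ltnn.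
rewrite RE ?(klc_zero hP) // => x Ex xw; apply: lower => // yx.
by apply: yw; apply: bruhat_le_trans yx xw.1.
Qed.

Definition KL_recursive E Rt P : Prop :=
  forall y w, E y -> E w -> bruhat_lt S y w ->
    gbar (P y w) - P y w =
    \sum_(x \in [set x | [/\ E x, bruhat_lt S y x & bruhat_le S x w]])
       gbar (Rt y x) * P x w.

Lemma KL_recursion M E (Gam : W -> M) (barM : M -> M) m1 Rt C P :
  is_basis E Gam -> module_bar barH m1 barM -> R_polynomials E Gam barM Rt ->
  KL_basis S E Gam barM C P -> KL_recursive E Rt P.
Proof.
move=> bG hM hR hC y w Ey Ew yw; have [Cbar Cex hP] := hC.
have Rtri := R_unitriangular bG hM hR hC.
have [s cs] := expansion_carrier (Cex w Ew); have [us sE s0] := cs.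
have -> : gbar (P y w) = \sum_(x <- s) gbar (Rt y x) * P x w.
  rewrite (bar_fixed_coefficients bG hM hR (Cex w Ew) cs (Cbar w Ew)) // gbar_sum.
  by apply: eq_bigr => x _; rewrite gbarM gbarK mulrC.
(* By triangularity of R and P, a term indexed by x in E with x <> y vanishes
   unless y < x <= w. *)
have -> : \sum_(x \in [set x | [/\ E x, bruhat_lt S y x & bruhat_le S x w]])
    gbar (Rt y x) * P x w =
  \sum_(x \in E) (if x == y then 0 else gbar (Rt y x) * P x w).
  rewrite fsbig_mkcond [RHS]fsbig_mkcond; apply: eq_fsbigr => x _.
  rewrite /patch; case: ifPn => [|].
    rewrite inE => -[Ex yx xw]; rewrite mem_set //; case: eqP => // xy.
    by case: yx => _ /(_ (esym xy)).
  rewrite notin_setE => nx; case: ifPn => //; rewrite inE => Ex.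
  case: eqP => // /nesym yx.
  have [xw|/(klc_zero hP Ex Ew) ->] := pselect (bruhat_le S x w);
    last by rewrite mulr0.
  have [le_yx|/((Rtri x Ex).2 _ Ey) ->] := pselect (bruhat_le S y x);
    last by rewrite gbar0 mul0r.
  by case: nx; split.
rewrite (fsbigE s) // => [|x Ex /(s0 _ Ex) ->]; last by rewrite mulr0 if_same.
rewrite (_ : \sum_(x <- s | x \in E) _ =
             \sum_(x <- s) (if x == y then 0 else gbar (Rt y x) * P x w)).
  have [ys|ys] := boolP (y \in s); last first.
    rewrite s0 // subr0 [LHS]big_seq [RHS]big_seq; apply: eq_bigr => x xs.
    by case: eqP => // xy; rewrite -xy xs in ys.
  rewrite (big_rem y ys) [RHS](big_rem y ys) /= eqxx add0r.
  rewrite (Rtri y Ey).1 gbar1 mul1r addrAC subrr add0r !big_seq.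
  apply: eq_bigr => x; rewrite mem_rem_uniq // inE => /andP[xy _].
  by rewrite (negPf xy).
rewrite big_seq_cond [RHS]big_seq; apply: eq_bigl => x.
by case: (boolP (x \in s)) => //= /sE Ex; rewrite mem_set.
Qed.

(** The support of a is positive, and that of gbar a is negative. *)
Lemma A_gt0_bar_fixed (a : A) : A_ge0 a -> const_term a = 0 -> gbar a = a -> a = 0.
Proof.
move=> a_ge0 a0 ba; apply: groupAlgP => g; rewrite mcoeff0.
apply/eqP/negPn/negP => ag.
have ng : 0 <= - g by apply: a_ge0; rewrite -gbar_coeff ba.
have g0 : g = 0.
  apply/eqP; rewrite eq_le (a_ge0 _ ag) andbT.
  by have := tog_leD2r _ _ g ng; rewrite add0r addNr.
by rewrite g0 (_ : a@_0 = 0) ?eqxx // in ag.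
Qed.

(** Descending induction on the length of z, started above the length of w: all
    terms on the right of the recursion for (z, w) have an index longer than z. *)
Lemma KL_coefficients_uniq E Rt P Q :
  KL_coefficients S E P -> KL_coefficients S E Q ->
  KL_recursive E Rt P -> KL_recursive E Rt Q ->
  forall y w, E y -> E w -> P y w = Q y w.
Proof.
move=> hP hQ recP recQ y w Ey Ew.
suff step k : forall z, E z -> (ell w < ell z + k)%N -> P z w = Q z w.
  by apply: (step (ell w).+1) => //; rewrite addnS ltnS leq_addl.
elim: k => [|k IHk] z Ez zk.
all: have [zw|nzw] := pselect (bruhat_le S z w);
  last by rewrite (klc_zero hP) ?(klc_zero hQ).
  rewrite addn0 in zk; have [->|/(ltn_trans zk)] := bruhat_le_len zw.
    by rewrite (klc_one hP) ?(klc_one hQ).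
  by rewrite ltnn.
have [->|nezw] := pselect (z = w); first by rewrite (klc_one hP) ?(klc_one hQ).
have lt_zw : bruhat_lt S z w by split.
apply/eqP; rewrite -subr_eq0; apply/eqP/A_gt0_bar_fixed.
- move=> g; rewrite mcoeffB => PQ.
  have [P0|] := eqVneq (P z w)@_g 0; last exact: (klc_ge0 hP).
  apply: (klc_ge0 hQ Ez Ew); apply: contra_neq PQ => ->; by rewrite P0 subr0.
- rewrite /const_term mcoeffB [X in X - _](klc_const hP Ez Ew nezw).
  by rewrite [X in - X](klc_const hQ Ez Ew nezw) subr0.
have := recP _ _ Ez Ew lt_zw.
have -> : \sum_(x \in [set x | [/\ E x, bruhat_lt S z x & bruhat_le S x w]])
       gbar (Rt z x) * P x w =
    \sum_(x \in [set x | [/\ E x, bruhat_lt S z x & bruhat_le S x w]])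
       gbar (Rt z x) * Q x w.
  apply: eq_fsbigr => x; rewrite inE => -[Ex /bruhat_lt_len zx _].
  rewrite IHk //; apply: leq_trans zk _.
  by rewrite addnS -addSn leq_add2r.
rewrite -(recQ _ _ Ez Ew lt_zw) gbarD gbarN => dPQ.
by move/eqP: dPQ; rewrite subr_eq => /eqP ->; rewrite -addrA addrC addrA subrK.
Qed.

Lemma sign_bar_unitriangular E P : KL_coefficients S E P ->
  unitriangular E ell (fun y w => eps y * gbar (P y w)).
Proof.
move=> hP; split=> [w Ew|y w Ey Ew yw le_wy].
  by exists (eps w); rewrite (klc_one hP Ew) gbar1 mulr1 eps_sq.
rewrite (klc_zero hP) ?gbar0 ?mulr0 // => /bruhat_le_len[//|].
by rewrite ltnNge le_wy.
Qed.
End KazhdanLusztig.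

Theorem proposition3p6
  (K : realType) (R : subringClosed (complex K)) (G : orderedGroupType)
  (W : groupType) (S : set W) (hWS : coxeter_system S)
  (L : W -> G) (hL : weight_function S L) (hL0 : forall s, S s -> 0 <= L s)
  (H : algType (groupAlg (subring_type R) G)) (T : W -> H)
  (hH : hecke_algebra S L T)
  (barH : {rmorphism H -> H}) (hbarH : hecke_bar T barH)
  (Phi : {lrmorphism H -> H}) (hPhi : hecke_phi S T barH Phi)
  (J : set W) (hJ : J `<=` S) (E : set W)
  (M : lmodType H) (Gam : W -> M)
  (r : W -> W -> W -> groupAlg (subring_type R) G) (barM : M -> M)
  (hE : wgraph_ideal S L T barH J E Gam r barM)
  (Mt : lmodType H) (Gamt : W -> Mt) (barMt : Mt -> Mt)
  (hMt : dual_module S L T barH J E r Gamt barMt)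
  (eta : M -> Mt) (heta : duality_map Phi Gam Gamt eta)
  (theta : Mt -> M) (etaK : cancel eta theta) (thetaK : cancel theta eta)
  (Rt : W -> W -> groupAlg (subring_type R) G)
  (hRt : R_polynomials E Gamt barMt Rt)
  (C : W -> M) (P : W -> W -> groupAlg (subring_type R) G)
  (hC : KL_basis S E Gam barM C P)
  (Ct : W -> Mt) (Pt : W -> W -> groupAlg (subring_type R) G)
  (hCt : KL_basis S E Gamt barMt Ct Pt) :
  (* (a) *)
  (dual_KL_basis S E Gam barM Rt (fun w => theta (Ct w)) Pt /\
   forall B : W -> M,
     (exists Q : W -> W -> groupAlg (subring_type R) G,
        dual_KL_basis S E Gam barM Rt B Q) ->
     forall w, E w -> B w = theta (Ct w)) /\
  (* (b) *)
  (is_basis E (fun w => eta (C w)) /\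
   forall w, E w ->
     expansion E Gamt (eta (C w))
       (fun y => eps S (groupAlg (subring_type R) G) y * gbar (P y w))).
Proof.
have [Eid E1 ED hM hMb] := hE.
have [bGt Gt_minus Gt_plus _ _ hMtb] := hMt.
have GamE := standard_cyclic hWS hH Eid (im_plus hM).
have GamtE := standard_cyclic hWS hH Eid Gt_plus.
have htheta := duality_map_inv hPhi etaK thetaK heta.
have [Cbar Cex hP] := hC; have [Ctbar Ctex hPt] := hCt.
have etaC w : E w -> expansion E Gamt (eta (C w))
    (fun y => eps S (groupAlg (subring_type R) G) y * gbar (P y w)).
  move=> Ew; rewrite -{1}(Cbar w Ew).
  exact: (duality_bar_expansion hbarH hPhi GamE GamtE hMb heta (Cex w Ew)).
have thetaCt w : E w -> expansion E Gam (theta (Ct w))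
    (fun y => eps S (groupAlg (subring_type R) G) y * gbar (Pt y w)).
  move=> Ew; rewrite -{1}(Ctbar w Ew).
  exact: (duality_bar_expansion hbarH hPhi GamtE GamE hMtb htheta (Ctex w Ew)).
have recPt := KL_recursion bGt hMtb hRt hCt.
split; split.
- split=> //.
  + exact: unitriangular_basis (sign_bar_unitriangular hPt) (im_basis hM) thetaCt.
  + move=> w Ew.
    rewrite (duality_bar_commute hbarH hPhi GamtE hMtb hMb htheta (Ctex w Ew)).
    by rewrite Ctbar.
- move=> B [Q [_ _ Bex hQ recQ]] w Ew.
  apply: expansion_fun (thetaCt w Ew); apply: eq_expansion (Bex w Ew) => y Ey.
  congr (_ * gbar _).
  exact: (KL_coefficients_uniq hQ hPt recQ recPt).
- exact: unitriangular_basis (sign_bar_unitriangular hP) bGt etaC.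
- exact: etaC.
Qed.
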